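(* Let $\{A(t,\varphi): t\in\mathbb R,\varphi\in E\}$ be a family of m-dissipative operators in $X$, and suppose that either (i) $A$ satisfies the uniformly continuous control condition with data $(h,k,K_0,L_1,L_2)$, where $h,k$ are Lipschitz continuous and $K_0<-\omega$, or (ii) $A$ satisfies the Lipschitz control condition with data $(g,h,k,K_0,L_1,L_2)$ and $L_g+K_0<-\omega$, where $L_g$ is the Lipschitz constant of $g$. Then the solution $u$ of $$u'(t)\in A(t,u_t)u(t)+\omega u(t),\quad t\in\mathbb R,$$ is globally Lipschitz continuous on $\mathbb R$.
   Context: $X$ is a Banach space, $\omega\in\mathbb R$, $\mathbb R^+=[0,\infty)$. $BUC(J,X)$ denotes the bounded uniformly continuous functions $J\to X$ with the sup norm. Either (infinite delay) $\mathbb I=(-\infty,0]$ and $E=BUC((-\infty,0],X)$, or (finite delay) $\mathbb I=[-r,0]$ for some $r>0$ and $E=C([-r,0],X)$; $E$ carries the sup norm $\|\cdot\|_E$. For $u\in BUC(\mathbb R,X)$ and $t\in\mathbb R$, $u_t\in E$ is $u_t(s)=u(t+s)$, $s\in\mathbb I$. The operators $A(t,\varphi)\subset X\times X$ may be multivalued, with domain depending on $(t,\varphi)$; m-dissipative means dissipative with $R(I-\lambda A(t,\varphi))=X$ for all $\lambda>0$. Uniformly continuous control condition with data $(h,k,K_0,L_1,L_2)$: $h,k:\mathbb R\to X$ are bounded and uniformly continuous, $K_0>0$, $L_1,L_2:\mathbb R^+\to\mathbb R^+$ are continuous and non-decreasing, and for all $\lambda>0$, $t_1,t_2\in\mathbb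 R$, $\varphi_1,\varphi_2\in E$, $[x_i,y_i]\in A(t_i,\varphi_i)$ ($i=1,2$), $$\|x_1-x_2\|\le\|x_1-x_2-\lambda(y_1-y_2)\|+\lambda\|h(t_1)-h(t_2)\|L_1(\|x_2\|)+\lambda\|k(t_1)-k(t_2)\|L_2(\|\varphi_2\|_E)+K_0\lambda\|\varphi_1-\varphi_2\|_E.$$ Lipschitz control condition with data $(g,h,k,K_0,L_1,L_2)$: $g,h,k:\mathbb R\to X$ are bounded and Lipschitz continuous, $K_0>0$, $L_1,L_2:\mathbb R^+\to\mathbb R^+$ are continuous and non-decreasing, and for all $\lambda>0$, $t_1,t_2\in\mathbb R$, $\varphi_1,\varphi_2\in E$, $[x_i,y_i]\in A(t_i,\varphi_i)$ ($i=1,2$), $$\|x_1-x_2\|\le\|x_1-x_2-\lambda(y_1-y_2)\|+\lambda\|h(t_1)-h(t_2)\|L_1(\|x_2\|)+\lambda\|g(t_1)-g(t_2)\|\,\|y_2\|+\lambda\|k(t_1)-k(t_2)\|L_2(\|\varphi_2\|_E)+K_0\lambda\|\varphi_1-\varphi_2\|_E.$$ Yosida approximation of the derivative: for $\lambda>0$ and $u\in BUC(\mathbb R,X)$, $(\partial_t)_\lambda u(t)=\frac1\lambda\Big(u(t)-\frac1\lambda\int_0^\infty e^{-\tau/\lambda}u(t-\tau)\,d\tau\Big)$. Recursion started at $\psi\in BUC(\mathbb R,X)$: for $\lambda>0$, $u_{1,\lambda}\in BUC(\mathbb R,X)$ is the (unique) solution of $(\partial_t)_\lambda u_{1,\lambda}(t)\in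 A(t,\psi_t)u_{1,\lambda}(t)+\omega u_{1,\lambda}(t)$, $t\in\mathbb R$; given $u_{n,\lambda}$, $u_{n+1,\lambda}\in BUC(\mathbb R,X)$ is the (unique) solution of $(\partial_t)_\lambda u_{n+1,\lambda}(t)\in A(t,(u_{n,\lambda})_t)u_{n+1,\lambda}(t)+\omega u_{n+1,\lambda}(t)$, $t\in\mathbb R$. Solution: the solution of $u'(t)\in A(t,u_t)u(t)+\omega u(t)$, $t\in\mathbb R$, is the function $u=\lim_{n\to\infty}\lim_{\lambda\to0+}u_{n,\lambda}$, both limits being uniform on $\mathbb R$. Under the hypotheses of the claim these limits exist for every starting point $\psi\in BUC(\mathbb R,X)$ and $u$ does not depend on $\psi$. *)

(* Defs.v *)
From Stdlib Require Import Reals Lra.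
From Coquelicot Require Import Coquelicot.

Open Scope R_scope.

(** * Functions with values in a normed space

    [S] is either [R] itself or a subinterval of [R], given as a subtype; [pos]
    is the embedding of [S] in [R]. *)

Section Functions.

Context {X : NormedModule R_AbsRing} {S : Type}.

Definition bounded (f : S -> X) : Prop :=
  exists M : R, forall s, norm (f s) <= M.

Definition unif_continuous (pos : S -> R) (f : S -> X) : Prop :=
  forall eps, 0 < eps -> exists delta, 0 < delta /\
    forall s1 s2, Rabs (pos s1 - pos s2) < delta ->
      norm (minus (f s1) (f s2)) < eps.

Definition continuous_sub (pos : S -> R) (f : S -> X) : Prop :=
  forall s eps, 0 < eps -> exists delta, 0 < delta /\
    forall s', Rabs (pos s' - pos s) < delta ->
      norm (minus (f s') (f s)) < eps.

(** The least upper bound is taken in [Rbar]; [real] sends infinite values to 0,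
    so this is the sup norm only for bounded [f] on a nonempty [S]. *)
Definition sup_norm (f : S -> X) : R :=
  real (Lub_Rbar (fun r => exists s, r = norm (f s))).

End Functions.

Definition lipschitz_with {X : NormedModule R_AbsRing} (f : R -> X) (L : R)
  : Prop :=
  forall s t, norm (minus (f s) (f t)) <= L * Rabs (s - t).

Definition lipschitz {X : NormedModule R_AbsRing} (f : R -> X) : Prop :=
  exists L, lipschitz_with f L.

Record BUC (X : NormedModule R_AbsRing) := mkBUC {
  BUC_fun :> R -> X;
  BUC_bounded : bounded BUC_fun;
  BUC_unif_continuous : unif_continuous (fun t => t) BUC_fun }.

Arguments BUC_fun {X} _ _.

(** * The history space *)

Inductive delay :=
  | Infinite_delay
  | Finite_delay (r : posreal).

Definition delay_set (d : delay) (s : R) : Prop :=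
  match d with
  | Infinite_delay => s <= 0
  | Finite_delay r => - r <= s <= 0
  end.

Definition delay_interval (d : delay) : Type := {s : R | delay_set d s}.

Definition history (d : delay) (X : NormedModule R_AbsRing) : Type :=
  { phi : delay_interval d -> X |
    match d with
    | Infinite_delay => bounded phi /\ unif_continuous (@proj1_sig _ _) phi
    | Finite_delay _ => continuous_sub (@proj1_sig _ _) phi
    end }.

Definition history_norm {d X} (phi : history d X) : R :=
  sup_norm (proj1_sig phi).

Definition history_dist {d X} (phi1 phi2 : history d X) : R :=
  sup_norm (fun s => minus (proj1_sig phi1 s) (proj1_sig phi2 s)).

Lemma segment_in_history {X : NormedModule R_AbsRing} (d : delay) (u : BUC X)
  (t : R) :
  let phi := fun s : delay_interval d => u (t + proj1_sig s) in
  match d with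
  | Infinite_delay => bounded phi /\ unif_continuous (@proj1_sig _ _) phi
  | Finite_delay _ => continuous_sub (@proj1_sig _ _) phi
  end.
Proof.
intros phi.
assert (H : unif_continuous (@proj1_sig _ _) phi).
{ intros eps Heps.
  destruct (BUC_unif_continuous _ u eps Heps) as [delta [Hd H]].
  exists delta; split; [exact Hd | intros s1 s2 Hs; apply H].
  replace (t + proj1_sig s1 - (t + proj1_sig s2))
    with (proj1_sig s1 - proj1_sig s2) by ring.
  exact Hs. }
destruct d as [|r].
- split; [|exact H].
  destruct (BUC_bounded _ u) as [M HM].
  exists M; intros s; apply HM.
- intros s eps Heps.
  destruct (H eps Heps) as [delta [Hd Hu]].
  exists delta; split; [exact Hd | intros s' Hs; apply Hu, Hs].
Qed.

Definition segment {X : NormedModule R_AbsRing} (d : delay) (u : BUC X) (t : R)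
  : history d X :=
  exist _ (fun s => u (t + proj1_sig s)) (segment_in_history d u t).

(** * Multivalued operators

    A subset of [X * X] is a relation; [B x y] stands for [[x, y] ∈ B]. *)

Definition dissipative {X : NormedModule R_AbsRing} (B : X -> X -> Prop)
  : Prop :=
  forall lambda x1 y1 x2 y2, 0 < lambda -> B x1 y1 -> B x2 y2 ->
    norm (minus x1 x2) <=
    norm (minus (minus x1 x2) (scal lambda (minus y1 y2))).

Definition m_dissipative {X : NormedModule R_AbsRing} (B : X -> X -> Prop)
  : Prop :=
  dissipative B /\
  forall lambda z, 0 < lambda ->
    exists x y, B x y /\ minus x (scal lambda y) = z.

(** Only the values on [[0, +oo)] are constrained. *)
Definition control_function (L : R -> R) : Prop :=
  (forall x, 0 <= x -> 0 <= L x) /\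
  continuous_on (fun x => 0 <= x) L /\
  (forall x y, 0 <= x -> x <= y -> L x <= L y).

Section Control.

Context {X : NormedModule R_AbsRing} {d : delay}.
Variable A : R -> history d X -> X -> X -> Prop.

Definition unif_continuous_control (h k : R -> X) (K0 : R) (L1 L2 : R -> R)
  : Prop :=
  (bounded h /\ unif_continuous (fun t => t) h) /\
  (bounded k /\ unif_continuous (fun t => t) k) /\
  0 < K0 /\ control_function L1 /\ control_function L2 /\
  forall lambda t1 t2 phi1 phi2 x1 y1 x2 y2,
    0 < lambda -> A t1 phi1 x1 y1 -> A t2 phi2 x2 y2 ->
    norm (minus x1 x2) <=
      norm (minus (minus x1 x2) (scal lambda (minus y1 y2)))
      + lambda * norm (minus (h t1) (h t2)) * L1 (norm x2)
      + lambda * norm (minus (k t1) (k t2)) * L2 (history_norm phi2)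
      + K0 * lambda * history_dist phi1 phi2.

Definition lipschitz_control (g h k : R -> X) (K0 : R) (L1 L2 : R -> R)
  : Prop :=
  (bounded g /\ lipschitz g) /\
  (bounded h /\ lipschitz h) /\
  (bounded k /\ lipschitz k) /\
  0 < K0 /\ control_function L1 /\ control_function L2 /\
  forall lambda t1 t2 phi1 phi2 x1 y1 x2 y2,
    0 < lambda -> A t1 phi1 x1 y1 -> A t2 phi2 x2 y2 ->
    norm (minus x1 x2) <=
      norm (minus (minus x1 x2) (scal lambda (minus y1 y2)))
      + lambda * norm (minus (h t1) (h t2)) * L1 (norm x2)
      + lambda * norm (minus (g t1) (g t2)) * norm y2
      + lambda * norm (minus (k t1) (k t2)) * L2 (history_norm phi2)
      + K0 * lambda * history_dist phi1 phi2.

End Control.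

(** * The approximation scheme and the solution *)

Section Solution.

Context {X : CompleteNormedModule R_AbsRing} {d : delay}.

Definition yosida_derivative (lambda : R) (u : R -> X) (t : R) : X :=
  scal (/ lambda)
    (minus (u t)
       (scal (/ lambda)
          (RInt_gen (fun tau => scal (exp (- tau / lambda)) (u (t - tau)))
             (at_point 0) (Rbar_locally p_infty)))).

Variables (omega : R) (A : R -> history d X -> X -> X -> Prop).

(** [(d/dt)_lambda u(t) ∈ A(t, v_t) u(t) + omega u(t)] for all [t]. *)
Definition approximate_solution (lambda : R) (v u : BUC X) : Prop :=
  forall t, exists y, A t (segment d v t) (u t) y /\
    yosida_derivative lambda u t = plus y (scal omega (u t)).

(** [U n lambda] is [u_{n,lambda}] for [n >= 1], and [U 0 lambda] is the
    starting point [psi]; the values at [lambda <= 0] are irrelevant. *)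
Definition recursion_from (psi : BUC X) (U : nat -> R -> BUC X) : Prop :=
  forall lambda, 0 < lambda ->
    U O lambda = psi /\
    forall n, approximate_solution lambda (U n lambda) (U (S n) lambda).

(** Uniform convergence is convergence in [fct_UniformSpace R X]. *)
Definition solution_from (psi : BUC X) (u : R -> X) : Prop :=
  exists (U : nat -> R -> BUC X) (v : nat -> R -> X),
    recursion_from psi U /\
    (forall n, (1 <= n)%nat ->
       filterlim (fun lambda => BUC_fun (U n lambda)) (at_right 0)
         (locally (T := fct_UniformSpace R X) (v n))) /\
    filterlim v eventually (locally (T := fct_UniformSpace R X) u).

(** The limit does not depend on [psi], so one starting point is enough. *)
Definition is_solution (u : R -> X) : Prop :=
  exists psi : BUC X, solution_from psi u.

End Solution.

(* Main.v *)
Require Import Defs.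
From Stdlib Require Import Reals Lra Classical_Prop IndefiniteDescription.
From Coquelicot Require Import Coquelicot.

Open Scope R_scope.

(** Case (i) is case (ii) with [g = 0], [Lg = 0].

    An arbitrary starting point [psi] is not Lipschitz, and then neither need
    the iterates [u_{n,lambda}] be.  For fixed [lambda] we therefore compare
    them with the solution [w] of the equation
    [(d/dt)_lambda w ∈ A(t, w_t) w + omega w], obtained by Banach's fixed point
    theorem in a set of bounded Lipschitz functions.  The control condition at
    equal times gives [|u_{n,lambda} - w| <= rho^n |psi - w|] with
    [rho = K0 / (- omega) < 1].  The control condition at times [t], [s]
    gives that [w] is Lipschitz with constant
    [(Lh L1(M) + Lg |omega| M + Lk L2(M)) / (- omega - Lg - K0)], where [M]
    bounds [w]: the term [|g(t) - g(s)| |y|] is controlled because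
    [|(d/dt)_lambda w|] is at most the Lipschitz constant of [w].  Neither [M]
    nor this constant depends on [lambda], so it is inherited by [u] when
    first [n] is taken large and then [lambda] small. *)

(** * Normed spaces and suprema *)

Lemma minus_exchange {G : AbelianGroup} (x y z w : G) :
  minus (minus x y) (minus z w) = minus (minus x z) (minus y w).
Proof.
unfold minus; rewrite (opp_plus z), (opp_plus y), <- !plus_assoc; f_equal.
rewrite !plus_assoc; f_equal; apply plus_comm.
Qed.

Lemma plus_plus_swap {G : AbelianGroup} (x y z : G) :
  plus (plus x y) z = plus (plus x z) y.
Proof. rewrite <- !plus_assoc; f_equal; apply plus_comm. Qed.

Lemma minus_plus_l {G : AbelianGroup} (x y : G) : minus (plus x y) x = y.
Proof.
transitivity (plus y zero); [|apply plus_zero_r].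
unfold minus; rewrite (plus_comm x), <- plus_assoc; f_equal; apply plus_opp_r.
Qed.

Lemma minus_minus_cancel {G : AbelianGroup} (x y : G) :
  minus x (minus x y) = y.
Proof.
transitivity (plus zero y); [|apply plus_zero_l].
unfold minus; rewrite (opp_plus x), (opp_opp y), plus_assoc; f_equal.
apply plus_opp_r.
Qed.

Section NormedSpaces.

Context {X : NormedModule R_AbsRing}.

Lemma norm_minus_sym (x y : X) : norm (minus x y) = norm (minus y x).
Proof. now rewrite <- norm_opp, opp_minus. Qed.

Lemma norm_minus_diag (x : X) : norm (minus x x) = 0.
Proof.
transitivity (norm (zero : X)); [f_equal; exact (minus_eq_zero (G := X) x)|apply norm_zero].
Qed.

Lemma norm_minus_triangle (z x y : X) :
  norm (minus x y) <= norm (minus x z) + norm (minus z y).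
Proof. rewrite (minus_trans z x y); apply norm_triangle. Qed.

Lemma norm_le_minus (x y : X) : norm x <= norm (minus x y) + norm y.
Proof.
replace x with (plus (minus x y) y) at 1; [apply norm_triangle|].
unfold minus; now rewrite <- plus_assoc, plus_opp_l, plus_zero_r.
Qed.

Lemma norm_minus_le (x y : X) : norm (minus x y) <= norm x + norm y.
Proof. rewrite <- (norm_opp y); apply norm_triangle. Qed.

Lemma norm_scal_le (a : R) (x : X) : norm (scal a x) <= Rabs a * norm x.
Proof. exact (norm_scal a x). Qed.

Lemma norm_minus_scal_le (a : R) (x y : X) :
  norm (minus (G := X) (scal a x) (scal a y)) <= Rabs a * norm (minus x y).
Proof.
apply Rle_trans with (2 := norm_scal_le a (minus x y)).
right; f_equal; exact (eq_sym (scal_minus_distr_l a x y)).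
Qed.

Lemma minus_minus_scal (a : R) (x1 x2 y1 y2 : X) :
  minus (minus x1 x2) (scal a (minus y1 y2))
  = minus (minus x1 (scal a y1)) (minus x2 (scal a y2)).
Proof.
rewrite (minus_exchange (G := X)); f_equal; exact (scal_minus_distr_l a y1 y2).
Qed.

Lemma scal_scal (a b : R) (x : X) : scal a (scal b x) = scal (a * b) x.
Proof. exact (scal_assoc a b x). Qed.

Lemma scal_Rplus (a b : R) (x : X) :
  plus (scal a x) (scal b x) = scal (a + b) x.
Proof. exact (eq_sym (scal_distr_r a b x)). Qed.

Lemma opp_scal (a : R) (x : X) : opp (scal a x) = scal (- a) x.
Proof. exact (eq_sym (scal_opp_l a x)). Qed.

Lemma scal_R1 (x : X) : scal 1 x = x.
Proof. exact (scal_one x). Qed.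

Lemma scal_R0 (x : X) : scal 0 x = zero.
Proof. exact (scal_zero_l x). Qed.

(** An infinite supremum, as for an empty [S], is sent to 0 by [real]; the hypothesis [0 <= b]
    covers that case. *)
Lemma sup_norm_le {S : Type} (f : S -> X) (b : R) :
  0 <= b -> (forall s, norm (f s) <= b) -> sup_norm f <= b.
Proof.
intros Hb Hf; unfold sup_norm.
destruct (Lub_Rbar_correct (fun r => exists s, r = norm (f s))) as [_ H].
specialize (H b); destruct (Lub_Rbar _); simpl in *; try exact Hb.
apply H; intros x [s ->]; apply Hf.
Qed.

Lemma sup_norm_ge0 {S : Type} (f : S -> X) : 0 <= sup_norm f.
Proof.
unfold sup_norm.
destruct (Lub_Rbar_correct (fun r => exists s, r = norm (f s))) as [Hub Hlub].
destruct (Lub_Rbar _) as [r| |]; simpl; try apply Rle_refl.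
destruct (Rle_lt_dec 0 r) as [H|H]; [exact H|exfalso].
(* If the supremum [r] were negative, no norm could lie below it, so the set would be empty and
   [m_infty] would be a smaller upper bound. *)
apply (Hlub m_infty); intros x [s ->].
assert (Hs := Hub (norm (f s)) (ex_intro _ s eq_refl)); simpl in Hs.
generalize (norm_ge_0 (f s)); lra.
Qed.

Lemma lipschitz_with_ge0 (f : R -> X) (L : R) : lipschitz_with f L -> 0 <= L.
Proof.
intros H; generalize (H 1 0) (norm_ge_0 (minus (f 1) (f 0))).
rewrite Rminus_0_r, Rabs_R1; lra.
Qed.

Lemma lipschitz_with_unif_continuous (f : R -> X) (L : R) :
  lipschitz_with f L -> unif_continuous (fun t => t) f.
Proof.
intros HL eps Heps; assert (H0 := lipschitz_with_ge0 f L HL).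
exists (eps / (L + 1)); split; [apply Rdiv_lt_0_compat; lra|].
intros s t Hst; apply Rle_lt_trans with (1 := HL s t).
apply Rle_lt_trans with ((L + 1) * Rabs (s - t)).
{ generalize (Rabs_pos (s - t)); lra. }
apply Rlt_le_trans with ((L + 1) * (eps / (L + 1))).
{ apply Rmult_lt_compat_l; lra. }
right; field; lra.
Qed.

End NormedSpaces.

(** * Passing to limits and suprema in real inequalities *)

Lemma le_of_le_geometric (theta a b c : R) :
  0 <= theta < 1 -> (forall n, a <= b + c * theta ^ n) -> a <= b.
Proof.
intros Ht H.
assert (Hlim : is_lim_seq (fun n => b + c * theta ^ n) (b + c * 0)).
{ apply is_lim_seq_plus'; [apply is_lim_seq_const|].
  apply (is_lim_seq_scal_l _ c 0), is_lim_seq_geom.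
  rewrite Rabs_pos_eq; lra. }
rewrite Rmult_0_r, Rplus_0_r in Hlim.
exact (is_lim_seq_le _ _ _ _ H (is_lim_seq_const a) Hlim).
Qed.

(** The supremum [m] of [f] is itself an admissible [b], so [m <= theta * m + c]. The a priori bound
    [B] makes [m] finite and is absent from the conclusion; in this way bounds depending on [lambda]
    are traded for uniform ones. *)
Lemma sup_self_improvement {T : Type} (f : T -> R) (B theta c : R) :
  theta < 1 -> (forall x, f x <= B) ->
  (forall b, (forall x, f x <= b) -> forall x, f x <= theta * b + c) ->
  forall x, f x <= c / (1 - theta).
Proof.
intros Ht HB Himp x0.
destruct (completeness (fun r => exists x, r = f x)) as [m [Hub Hlub]].
- exists B; intros r [x ->]; apply HB.
- exists (f x0), x0; reflexivity.
- assert (Hm : forall x, f x <= m) by (intros x; apply Hub; now exists x).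
  assert (m <= theta * m + c).
  { apply Hlub; intros r [x ->]; now apply Himp. }
  apply Rle_trans with (1 := Hm x0).
  apply Rmult_le_reg_r with (1 - theta); [lra|].
  unfold Rdiv; rewrite Rmult_assoc, Rinv_l; lra.
Qed.

(** * Improper integrals *)

Section ImproperIntegrals.

Context {X : CompleteNormedModule R_AbsRing}.

Lemma is_RInt_gen_of_primitive (f F : R -> X) (l : X) :
  (forall b, 0 <= b -> is_RInt f 0 b (F b)) ->
  filterlim F (Rbar_locally p_infty) (locally l) ->
  is_RInt_gen f (at_point 0) (Rbar_locally p_infty) l.
Proof.
intros Hf HF.
apply (filterlimi_lim_ext_loc (fun ab : R * R => F (snd ab))).
- exists (fun a => a = 0) (fun b => 0 < b); [reflexivity|now exists 0|].
  intros a b -> Hb; simpl; apply Hf; lra.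
- apply filterlim_comp with (2 := HF); apply filterlim_snd.
Qed.

(** Cauchy criterion: the increments of the integral of [f] from 0 to [b] are dominated by those of
    [G], which converges at infinity. *)
Lemma ex_RInt_gen_dominated (f : R -> X) (g G : R -> R) (l : R) :
  (forall x, continuous f x) ->
  (forall a b, a <= b -> is_RInt g a b (G b - G a)) ->
  (forall x, norm (f x) <= g x) ->
  filterlim G (Rbar_locally p_infty) (locally l) ->
  exists I, is_RInt_gen f (at_point 0) (Rbar_locally p_infty) I.
Proof.
intros Hf Hg Hfg HG.
assert (Hex : forall a b, ex_RInt f a b).
{ intros a b; apply ex_RInt_continuous; intros; apply Hf. }
assert (Hdist : forall a b, a <= b ->
  norm (minus (RInt f 0 b) (RInt f 0 a)) <= Rabs (G b - G a)).
{ intros a b Hab; apply Rle_trans with (2 := Rle_abs _).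
  apply (norm_RInt_le f g a b) with (1 := Hab); [now intros| |now apply Hg].
  replace (minus _ _) with (RInt f a b); [now apply RInt_correct|].
  rewrite <- (RInt_Chasles f 0 a b) by easy.
  symmetry; apply (minus_plus_l (RInt f 0 a)). }
destruct (proj1 (filterlim_locally_cauchy (F := Rbar_locally p_infty)
  (fun b => RInt f 0 b))) as [I HI].
- intros eps.
  destruct (proj2 (filterlim_locally_cauchy (F := Rbar_locally p_infty) G)
    (ex_intro _ l HG) eps) as [P [HP HPG]].
  exists P; split; [exact HP|]; intros a b Ha Hb; apply (norm_compat1 (V := X)).
  destruct (Rle_lt_dec a b) as [Hab|Hab].
  + apply Rle_lt_trans with (1 := Hdist a b Hab); exact (HPG a b Ha Hb).
  + rewrite norm_minus_sym.
    apply Rle_lt_trans with (1 := Hdist b a (Rlt_le _ _ Hab)).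
    exact (HPG b a Hb Ha).
- exists I; apply is_RInt_gen_of_primitive with (2 := HI).
  intros b _; now apply RInt_correct.
Qed.

End ImproperIntegrals.

(** * Mass and first moment of the exponential kernel *)

Lemma is_lim_neg_div (lambda : R) :
  0 < lambda -> is_lim (fun tau => - tau / lambda) p_infty m_infty.
Proof.
intros Hl; assert (0 < / lambda) by now apply Rinv_0_lt_compat.
apply (is_lim_ext (fun tau => (- / lambda) * tau)); [intros; field; lra|].
replace m_infty with (Rbar_mult (- / lambda) p_infty).
- apply is_lim_scal_l, is_lim_id.
- simpl; destruct (Rle_dec 0 (- / lambda)); [exfalso; lra|reflexivity].
Qed.

Lemma is_lim_exp_neg_div (lambda : R) :
  0 < lambda -> is_lim (fun tau => exp (- tau / lambda)) p_infty 0.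
Proof.
intros Hl.
apply (is_lim_comp exp (fun tau => - tau / lambda) p_infty 0 m_infty).
- apply is_lim_exp_m.
- now apply is_lim_neg_div.
- exists 0; easy.
Qed.

Lemma is_lim_id_mult_exp_neg_div (lambda : R) :
  0 < lambda -> is_lim (fun tau => tau * exp (- tau / lambda)) p_infty 0.
Proof.
intros Hl.
apply (is_lim_ext (fun tau =>
  - lambda * ((- tau / lambda) * exp (- tau / lambda)))).
{ intros; field; lra. }
replace (Finite 0) with (Rbar_mult (- lambda) 0) by (simpl; f_equal; ring).
apply is_lim_scal_l.
apply (is_lim_comp (fun y => y * exp y) (fun tau => - tau / lambda)
  p_infty 0 m_infty).
- apply is_lim_mul_exp_m.
- now apply is_lim_neg_div.
- exists 0; easy.
Qed.

Lemma continuous_exp_neg_div (lambda tau : R) :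
  continuous (fun tau => exp (- tau / lambda)) tau.
Proof.
apply (ex_derive_continuous (fun tau => exp (- tau / lambda))).
auto_derive; easy.
Qed.

Lemma is_RInt_exp_neg_div (lambda c a b : R) :
  0 < lambda ->
  is_RInt (fun tau => c * exp (- tau / lambda)) a b
    (- c * lambda * exp (- b / lambda) - - c * lambda * exp (- a / lambda)).
Proof.
intros Hl.
apply (is_RInt_derive (fun tau => - c * lambda * exp (- tau / lambda))).
- intros; auto_derive; [easy|unfold Rdiv; field; lra].
- intros; apply (ex_derive_continuous (fun tau => c * exp (- tau / lambda))).
  auto_derive; easy.
Qed.

(** A primitive is $-c\lambda(\tau+\lambda)e^{-\tau/\lambda}$; it vanishes at infinity and equals
    $-c\lambda^2$ at 0. *)
Lemma is_RInt_gen_id_mult_exp_neg_div (lambda c : R) :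
  0 < lambda ->
  is_RInt_gen (fun tau => c * (tau * exp (- tau / lambda)))
    (at_point 0) (Rbar_locally p_infty) (c * (lambda * lambda)).
Proof.
intros Hl.
apply is_RInt_gen_of_primitive with (fun b =>
  - c * lambda * (b * exp (- b / lambda) + lambda * exp (- b / lambda))
  - - c * lambda * (0 * exp (- 0 / lambda) + lambda * exp (- 0 / lambda))).
- intros b _.
  apply (is_RInt_derive (fun tau =>
    - c * lambda * (tau * exp (- tau / lambda) + lambda * exp (- tau / lambda)))).
  + intros; auto_derive; [easy|unfold Rdiv; field; lra].
  + intros; apply (ex_derive_continuous
      (fun tau => c * (tau * exp (- tau / lambda)))).
    auto_derive; easy.
- replace (c * (lambda * lambda)) with (- c * lambda * (0 + lambda * 0)
    - - c * lambda * (0 * exp (- 0 / lambda) + lambda * exp (- 0 / lambda))).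
  2: { replace (- 0 / lambda) with 0 by (field; lra); rewrite exp_0; ring. }
  apply (is_lim_minus' _ _ p_infty); [|apply is_lim_const].
  apply (is_lim_scal_l _ _ p_infty (Finite (0 + lambda * 0))).
  apply is_lim_plus'; [now apply is_lim_id_mult_exp_neg_div|].
  apply (is_lim_scal_l _ _ p_infty (Finite 0)); now apply is_lim_exp_neg_div.
Qed.

Lemma is_RInt_gen_exp_neg_div_const {X : CompleteNormedModule R_AbsRing}
  (lambda : R) (x : X) :
  0 < lambda ->
  is_RInt_gen (fun tau => scal (exp (- tau / lambda)) x)
    (at_point 0) (Rbar_locally p_infty) (scal lambda x).
Proof.
intros Hl.
assert (Hd : forall b, is_derive (fun tau => lambda * (1 - exp (- tau / lambda)))
  b (exp (- b / lambda))).
{ intros b; auto_derive; [easy|unfold Rdiv; field; lra]. }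
apply is_RInt_gen_of_primitive with
  (fun b => scal (lambda * (1 - exp (- b / lambda))) x).
- intros b _.
  replace (scal (lambda * (1 - exp (- b / lambda))) x) with
    (minus (scal (lambda * (1 - exp (- b / lambda))) x)
       (scal (lambda * (1 - exp (- 0 / lambda))) x)).
  + apply (is_RInt_derive
      (fun tau => scal (lambda * (1 - exp (- tau / lambda))) x)).
    * intros; apply (is_derive_scal_l (V := X)), Hd.
    * intros; apply (continuous_scal (V := X)); [|apply continuous_const].
      apply continuous_exp_neg_div.
  + replace (lambda * (1 - exp (- 0 / lambda))) with 0.
    * etransitivity; [apply f_equal, (scal_R0 x)|apply (minus_zero_r (G := X))].
    * replace (- 0 / lambda) with 0 by (field; lra); rewrite exp_0; ring.
- apply (filterlim_comp _ _ _ (fun b => lambda * (1 - exp (- b / lambda)))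
    (fun r => scal r x) _ (locally lambda)).
  + replace (locally lambda) with (Rbar_locally (lambda * (1 - 0)))
      by (rewrite Rminus_0_r, Rmult_1_r; reflexivity).
    apply (is_lim_scal_l _ _ p_infty (Finite (1 - 0))).
    apply (is_lim_minus' _ _ p_infty); [apply is_lim_const|now apply is_lim_exp_neg_div].
  + apply (filterlim_scal_l (V := X)).
Qed.

(** * The exponential average *)

Section Average.

Context {X : CompleteNormedModule R_AbsRing}.

(** The resolvent $(I+\lambda\,d/dt)^{-1}$ applied to [p]. The Yosida derivative of [p] is the
    difference of [p] and its average, divided by [lambda]. *)
Definition average (lambda : R) (p : R -> X) (t : R) : X :=
  scal (/ lambda)
    (RInt_gen (fun tau => scal (exp (- tau / lambda)) (p (t - tau)))
       (at_point 0) (Rbar_locally p_infty)).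

Lemma BUC_continuous_reflect (p : BUC X) (t tau : R) :
  continuous (fun tau => p (t - tau)) tau.
Proof.
apply (filterlim_locally_ball_norm (U := X)); intros eps.
destruct (BUC_unif_continuous _ p eps (cond_pos eps)) as [delta [Hd H]].
exists (mkposreal delta Hd); intros y Hy; apply H.
replace (t - y - (t - tau)) with (- (y - tau)) by ring.
rewrite Rabs_Ropp; exact Hy.
Qed.

(** [RInt_gen] is total, so its value is usable only once convergence is known; here the integrand
    is dominated by $M e^{-\tau/\lambda}$, with [M] a bound of [p]. *)
Lemma average_is_RInt_gen (lambda : R) (p : BUC X) (t : R) :
  0 < lambda ->
  exists I : X, average lambda p t = scal (/ lambda) I /\
    is_RInt_gen (fun tau => scal (exp (- tau / lambda)) (p (t - tau)))
      (at_point 0) (Rbar_locally p_infty) I.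
Proof.
intros Hl; destruct (BUC_bounded _ p) as [M HM].
destruct (ex_RInt_gen_dominated
  (fun tau => scal (exp (- tau / lambda)) (p (t - tau)))
  (fun tau => M * exp (- tau / lambda))
  (fun tau => - M * lambda * exp (- tau / lambda)) (- M * lambda * 0))
  as [I HI].
- intros tau; apply (continuous_scal (V := X)).
  + apply continuous_exp_neg_div.
  + apply BUC_continuous_reflect.
- intros; now apply is_RInt_exp_neg_div.
- intros tau; apply Rle_trans with (1 := norm_scal_le (X := X) _ _).
  rewrite Rabs_pos_eq by (left; apply exp_pos).
  rewrite Rmult_comm; apply Rmult_le_compat_r; [left; apply exp_pos|apply HM].
- apply (is_lim_scal_l _ _ p_infty (Finite 0)); now apply is_lim_exp_neg_div.
- exists I; split; [|exact HI].
  unfold average; f_equal; now apply is_RInt_gen_unique.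
Qed.

Lemma norm_RInt_gen_half_line_le (f : R -> X) (g : R -> R) (If : X) (Ig : R) :
  (forall tau, 0 <= tau -> norm (f tau) <= g tau) ->
  is_RInt_gen f (at_point 0) (Rbar_locally p_infty) If ->
  is_RInt_gen g (at_point 0) (Rbar_locally p_infty) Ig ->
  norm If <= Ig.
Proof.
intros Hfg HIf HIg.
refine (RInt_gen_norm f g If Ig _ _ HIf HIg).
- exists (fun a => a = 0) (fun b => 0 < b); [reflexivity|now exists 0|].
  intros a b -> Hb; simpl; lra.
- exists (fun a => a = 0) (fun b => 0 < b); [reflexivity|now exists 0|].
  intros a b -> _ tau [Htau _]; now apply Hfg.
Qed.

(** The kernel $e^{-\tau/\lambda}/\lambda$ is positive with mass 1, so averaging is nonexpansive.
    Two functions and two base points are allowed, so that the estimate serves both for comparing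
    functions and for shifting one function in time. *)
Lemma average_dist (lambda : R) (p q : BUC X) (t s b : R) :
  0 < lambda ->
  (forall tau, 0 <= tau -> norm (minus (p (t - tau)) (q (s - tau))) <= b) ->
  norm (minus (average lambda p t) (average lambda q s)) <= b.
Proof.
intros Hl Hb.
destruct (average_is_RInt_gen lambda p t Hl) as [Ip [-> HIp]].
destruct (average_is_RInt_gen lambda q s Hl) as [Iq [-> HIq]].
apply Rle_trans with (1 := norm_minus_scal_le (X := X) _ _ _).
rewrite Rabs_pos_eq by (left; now apply Rinv_0_lt_compat).
apply Rmult_le_reg_l with (1 := Hl).
rewrite <- Rmult_assoc, Rinv_r, Rmult_1_l by lra.
apply norm_RInt_gen_half_line_le with
  (f := fun tau => minus (scal (exp (- tau / lambda)) (p (t - tau)))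
    (scal (exp (- tau / lambda)) (q (s - tau))))
  (g := fun tau => scal (exp (- tau / lambda)) b).
- intros tau Htau.
  apply Rle_trans with (1 := norm_minus_scal_le (X := X) _ _ _).
  rewrite Rabs_pos_eq by (left; apply exp_pos).
  apply Rmult_le_compat_l; [left; apply exp_pos|now apply Hb].
- now apply (is_RInt_gen_minus (V := X)).
- now apply (is_RInt_gen_exp_neg_div_const (X := R_CompleteNormedModule)).
Qed.

Lemma average_bound (lambda : R) (p : BUC X) (t b : R) :
  0 < lambda -> (forall s, norm (p s) <= b) -> norm (average lambda p t) <= b.
Proof.
intros Hl Hb.
destruct (average_is_RInt_gen lambda p t Hl) as [I [-> HI]].
apply Rle_trans with (1 := norm_scal_le (X := X) _ _).
rewrite Rabs_pos_eq by (left; now apply Rinv_0_lt_compat).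
apply Rmult_le_reg_l with (1 := Hl).
rewrite <- Rmult_assoc, Rinv_r, Rmult_1_l by lra.
apply norm_RInt_gen_half_line_le with (2 := HI)
  (g := fun tau => scal (exp (- tau / lambda)) b).
- intros tau Htau; apply Rle_trans with (1 := norm_scal_le (X := X) _ _).
  rewrite Rabs_pos_eq by (left; apply exp_pos).
  apply Rmult_le_compat_l; [left; apply exp_pos|now apply Hb].
- now apply (is_RInt_gen_exp_neg_div_const (X := R_CompleteNormedModule)).
Qed.

(** [p t] is the average of a constant, so the difference is at most [L] times the mean [lambda] of
    the kernel. After division by [lambda], the Yosida derivative is bounded by [L]. *)
Lemma minus_average_lipschitz (lambda : R) (p : BUC X) (L t : R) :
  0 < lambda -> lipschitz_with p L ->
  norm (minus (p t) (average lambda p t)) <= lambda * L.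
Proof.
intros Hl HL.
destruct (average_is_RInt_gen lambda p t Hl) as [I [-> HI]].
replace (p t) with (scal (/ lambda) (scal lambda (p t))).
2: { rewrite scal_scal, Rinv_l by lra; apply scal_R1. }
apply Rle_trans with (1 := norm_minus_scal_le (X := X) _ _ _).
rewrite Rabs_pos_eq by (left; now apply Rinv_0_lt_compat).
apply Rmult_le_reg_l with (1 := Hl).
rewrite <- Rmult_assoc, Rinv_r, Rmult_1_l by lra.
replace (lambda * (lambda * L)) with (L * (lambda * lambda)) by ring.
apply norm_RInt_gen_half_line_le with
  (f := fun tau => minus (scal (exp (- tau / lambda)) (p t))
    (scal (exp (- tau / lambda)) (p (t - tau))))
  (g := fun tau => L * (tau * exp (- tau / lambda))).
- intros tau Htau.
  apply Rle_trans with (1 := norm_minus_scal_le (X := X) _ _ _).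
  rewrite Rabs_pos_eq by (left; apply exp_pos).
  rewrite <- Rmult_assoc, (Rmult_comm (L * tau)).
  apply Rmult_le_compat_l; [left; apply exp_pos|].
  apply Rle_trans with (1 := HL t (t - tau)).
  replace (t - (t - tau)) with tau by ring; rewrite Rabs_pos_eq; lra.
- apply (is_RInt_gen_minus (V := X)) with (2 := HI).
  now apply is_RInt_gen_exp_neg_div_const.
- now apply is_RInt_gen_id_mult_exp_neg_div.
Qed.

End Average.

(** * Resolvent estimates *)

Section Segments.

Context {X : NormedModule R_AbsRing} {d : delay}.

Lemma history_norm_segment_le (v : BUC X) (t M : R) :
  (forall s, norm (v s) <= M) -> history_norm (segment d v t) <= M.
Proof.
intros HM; apply sup_norm_le; [|intros s; apply HM].
apply Rle_trans with (2 := HM 0), norm_ge_0.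
Qed.

Lemma history_dist_segment_le (v w : BUC X) (t s b : R) :
  0 <= b -> (forall r, norm (minus (v (t + r)) (w (s + r))) <= b) ->
  history_dist (segment d v t) (segment d w s) <= b.
Proof. intros Hb H; apply sup_norm_le; [exact Hb|intros r; apply H]. Qed.

Lemma history_dist_segment_lipschitz (v : BUC X) (L t s : R) :
  lipschitz_with v L ->
  history_dist (segment d v t) (segment d v s) <= L * Rabs (t - s).
Proof.
intros HL; apply history_dist_segment_le.
- apply Rmult_le_pos; [exact (lipschitz_with_ge0 v L HL)|apply Rabs_pos].
- intros r; apply Rle_trans with (1 := HL _ _).
  replace (t + r - (s + r)) with (t - s) by ring; apply Rle_refl.
Qed.

End Segments.

Section Estimates.

Context {X : NormedModule R_AbsRing} {d : delay}.
Variables (omega : R) (A : R -> history d X -> X -> X -> Prop).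
Variables (g h k : R -> X) (K0 : R) (L1 L2 : R -> R).
Hypothesis Homega : omega < 0.
Hypothesis Hcontrol : lipschitz_control A g h k K0 L1 L2.

(** [[x t, y] ∈ A(t, phi t)] with [(1 - lambda omega) x t - lambda y = z t]. *)
Definition resolves (lambda : R) (phi : R -> history d X) (z x : R -> X)
  : Prop :=
  forall t, exists y, A t (phi t) (x t) y /\
    minus (x t) (scal (lambda / (1 - lambda * omega)) y)
    = scal (/ (1 - lambda * omega)) (z t).

Lemma factor_gt1 (lambda : R) : 0 < lambda -> 1 < 1 - lambda * omega.
Proof.
intros Hl; assert (0 < lambda * - omega) by (apply Rmult_lt_0_compat; lra); lra.
Qed.

(** The control condition with parameter [lambda / (1 - lambda * omega)], multiplied by
    [1 - lambda * omega]: for this parameter the two resolvent equations turn the dissipative term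
    into a multiple of [minus z1 z2]. *)
Lemma resolvent_estimate (lambda t1 t2 : R) (phi1 phi2 : history d X)
  (x1 y1 x2 y2 z1 z2 : X) :
  0 < lambda -> A t1 phi1 x1 y1 -> A t2 phi2 x2 y2 ->
  minus x1 (scal (lambda / (1 - lambda * omega)) y1)
    = scal (/ (1 - lambda * omega)) z1 ->
  minus x2 (scal (lambda / (1 - lambda * omega)) y2)
    = scal (/ (1 - lambda * omega)) z2 ->
  (1 - lambda * omega) * norm (minus x1 x2) <=
    norm (minus z1 z2)
    + lambda * (norm (minus (h t1) (h t2)) * L1 (norm x2)
                + norm (minus (g t1) (g t2)) * norm y2
                + norm (minus (k t1) (k t2)) * L2 (history_norm phi2)
                + K0 * history_dist phi1 phi2).
Proof.
intros Hl H1 H2 E1 E2; assert (Hf := factor_gt1 lambda Hl).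
set (f := 1 - lambda * omega) in *.
destruct Hcontrol as (_ & _ & _ & _ & _ & _ & H).
assert (Hmu : 0 < lambda / f) by (apply Rdiv_lt_0_compat; lra).
specialize (H _ t1 t2 phi1 phi2 x1 y1 x2 y2 Hmu H1 H2).
rewrite minus_minus_scal, E1, E2 in H.
assert (Hz := norm_minus_scal_le (/ f) z1 z2).
rewrite (Rabs_pos_eq (/ f)) in Hz by (left; apply Rinv_0_lt_compat; lra).
apply Rmult_le_reg_l with (/ f); [apply Rinv_0_lt_compat; lra|].
rewrite <- Rmult_assoc, Rinv_l, Rmult_1_l by lra.
apply Rle_trans with (1 := H); unfold Rdiv; lra.
Qed.

(** Both solutions are compared at the same time, so the increments of [h], [g] and [k] vanish and
    only the history term with [K0] remains. *)
Lemma resolves_dist (lambda : R) (v1 v2 : BUC X) (z1 z2 w1 w2 : R -> X)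
  (b c : R) :
  0 < lambda -> 0 <= c ->
  resolves lambda (segment d v1) z1 w1 -> resolves lambda (segment d v2) z2 w2 ->
  (forall t, norm (minus (z1 t) (z2 t)) <= b) ->
  (forall t, norm (minus (v1 t) (v2 t)) <= c) ->
  forall t, (1 - lambda * omega) * norm (minus (w1 t) (w2 t))
    <= b + lambda * K0 * c.
Proof.
intros Hl Hc0 H1 H2 Hb Hc t.
destruct (H1 t) as [y1 [HA1 E1]], (H2 t) as [y2 [HA2 E2]].
apply Rle_trans with (1 := resolvent_estimate _ _ _ _ _ _ _ _ _ _ _
  Hl HA1 HA2 E1 E2).
rewrite !norm_minus_diag, !Rmult_0_l.
assert (HK0 : 0 < K0) by apply Hcontrol.
assert (Hd : history_dist (segment d v1 t) (segment d v2 t) <= c).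
{ apply history_dist_segment_le; auto. }
apply Rplus_le_compat; [apply Hb|].
replace (lambda * K0 * c) with (lambda * (K0 * c)) by ring.
apply Rmult_le_compat_l; [lra|].
rewrite !Rplus_0_l; apply Rmult_le_compat_l; lra.
Qed.

Variables (Lg Lh Lk : R).
Hypotheses (Hg : lipschitz_with g Lg) (Hh : lipschitz_with h Lh)
  (Hk : lipschitz_with k Lk).

(** The resolvent estimate at two times for one history function. The hypothesis on [Y] says that
    the elements [y] in [resolves] have norm at most [Y], which controls the term with [g]. It will
    be met by a crude [Y] depending on [lambda] and later by a sharp one. *)
Lemma resolves_shift (lambda : R) (v : BUC X) (z w : R -> X) (M Y Lv : R) :
  0 < lambda -> resolves lambda (segment d v) z w ->
  (forall t, norm (v t) <= M) -> (forall t, norm (w t) <= M) ->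
  lipschitz_with v Lv ->
  (forall t, norm (minus (w t) (scal (/ (1 - lambda * omega)) (z t)))
     <= lambda / (1 - lambda * omega) * Y) ->
  forall t s, (1 - lambda * omega) * norm (minus (w t) (w s))
    <= norm (minus (z t) (z s))
       + lambda * (Lh * L1 M + Lg * Y + Lk * L2 M + K0 * Lv) * Rabs (t - s).
Proof.
intros Hl HR Hv Hw HLv HY t s.
destruct (HR t) as [y1 [HA1 E1]], (HR s) as [y2 [HA2 E2]].
apply Rle_trans with (1 := resolvent_estimate _ _ _ _ _ _ _ _ _ _ _
  Hl HA1 HA2 E1 E2).
apply Rplus_le_compat_l; rewrite Rmult_assoc; apply Rmult_le_compat_l; [lra|].
destruct Hcontrol as (_ & _ & _ & HK0 & HL1 & HL2 & _).
destruct HL1 as (HL1p & _ & HL1m), HL2 as (HL2p & _ & HL2m).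
assert (Hy2 : norm y2 <= Y).
{ assert (Hf := factor_gt1 lambda Hl); specialize (HY s).
  set (f := 1 - lambda * omega) in *.
  assert (Hmu : 0 < lambda / f) by (apply Rdiv_lt_0_compat; lra).
  (* By the resolvent equation the difference in [HY] is exactly [scal (lambda / f) y2]. *)
  rewrite <- E2 in HY.
  rewrite (minus_minus_cancel (G := X)) in HY.
  apply Rmult_le_reg_l with (1 := Hmu); apply Rle_trans with (2 := HY).
  assert (Hi := norm_scal_le (/ (lambda / f)) (scal (lambda / f) y2)).
  rewrite scal_scal, Rinv_l, scal_R1 in Hi by lra.
  rewrite Rabs_pos_eq in Hi by (left; now apply Rinv_0_lt_compat).
  apply Rmult_le_reg_l with (/ (lambda / f)); [now apply Rinv_0_lt_compat|].
  rewrite <- Rmult_assoc, Rinv_l, Rmult_1_l by lra; exact Hi. }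
assert (Hn : 0 <= history_norm (segment d v s)) by apply sup_norm_ge0.
assert (Hns := history_norm_segment_le (d := d) v s M Hv).
assert (Hd := history_dist_segment_lipschitz (d := d) v Lv t s HLv).
assert (H1 : norm (minus (h t) (h s)) * L1 (norm (w s))
  <= Lh * Rabs (t - s) * L1 M).
{ apply Rmult_le_compat; [apply norm_ge_0|apply HL1p, norm_ge_0|apply Hh|].
  apply HL1m; [apply norm_ge_0|apply Hw]. }
assert (H2 : norm (minus (g t) (g s)) * norm y2 <= Lg * Rabs (t - s) * Y).
{ apply Rmult_le_compat; [apply norm_ge_0|apply norm_ge_0|apply Hg|exact Hy2]. }
assert (H3 : norm (minus (k t) (k s)) * L2 (history_norm (segment d v s))
  <= Lk * Rabs (t - s) * L2 M).
{ apply Rmult_le_compat; [apply norm_ge_0|now apply HL2p|apply Hk|].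
  now apply HL2m. }
assert (H4 : K0 * history_dist (segment d v t) (segment d v s)
  <= K0 * (Lv * Rabs (t - s))) by (apply Rmult_le_compat_l; lra).
lra.
Qed.

End Estimates.

(** * The full fixed point *)

Section FixedPoint.

Context {X : CompleteNormedModule R_AbsRing}.

Definition bounded_lipschitz (M L : R) (f : R -> X) : Prop :=
  (forall t, norm (f t) <= M) /\ lipschitz_with f L.

Lemma bounded_lipschitz_BUC (M L : R) (f : R -> X) :
  bounded_lipschitz M L f -> exists w : BUC X, BUC_fun w = f.
Proof.
intros [HM HL].
exists (mkBUC X f (ex_intro _ M HM) (lipschitz_with_unif_continuous f L HL)).
reflexivity.
Qed.

(** The rate is uniform in [m], so it survives the passage to the limit; the fixed point argument
    needs the rate and not only the limit. *)
Lemma geometric_cauchy_limit (W : nat -> X) (C theta : R) :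
  0 <= theta < 1 ->
  (forall n m, norm (minus (W (n + m)%nat) (W n)) <= C * theta ^ n) ->
  exists l, forall n, norm (minus l (W n)) <= C * theta ^ n.
Proof.
intros Ht HW.
assert (Hlim : is_lim_seq (fun n => C * theta ^ n) (C * 0)).
{ apply (is_lim_seq_scal_l _ C 0), is_lim_seq_geom; rewrite Rabs_pos_eq; lra. }
rewrite Rmult_0_r in Hlim.
destruct (proj1 (filterlim_locally_cauchy (F := eventually) W)) as [l Hl].
- intros eps.
  destruct (proj1 (filterlim_locally_ball_norm (U := R_NormedModule) _ _) Hlim
    (pos_div_2 eps)) as [N HN].
  assert (HN' := HN N (le_n N)); unfold ball_norm in HN'; simpl in HN'.
  change (Rabs (C * theta ^ N - 0) < eps / 2) in HN'.
  rewrite Rminus_0_r in HN'; assert (H := Rle_abs (C * theta ^ N)).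
  exists (fun n => (N <= n)%nat); split; [now exists N|].
  intros n m Hn Hm; apply (norm_compat1 (V := X)).
  apply Rle_lt_trans with (1 := norm_minus_triangle (X := X) (W N) _ _).
  rewrite (norm_minus_sym (X := X) (W N)).
  assert (H1 := HW N (n - N)%nat); assert (H2 := HW N (m - N)%nat).
  replace (N + (n - N))%nat with n in H1 by now rewrite Nat.add_comm, Nat.sub_add.
  replace (N + (m - N))%nat with m in H2 by now rewrite Nat.add_comm, Nat.sub_add.
  eapply Rle_lt_trans; [apply Rplus_le_compat; [exact H2|exact H1]|lra].
- exists l; intros n; apply Rle_plus_epsilon; intros eps Heps.
  destruct (proj1 (filterlim_locally_ball_norm (U := X) _ _) Hl
    (mkposreal eps Heps)) as [N HN].
  specialize (HN (n + N)%nat (Nat.le_add_l N n)); unfold ball_norm in HN.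
  apply Rle_trans with (1 := norm_minus_triangle (X := X) (W (n + N)%nat) _ _).
  rewrite (norm_minus_sym (X := X) l), Rplus_comm.
  apply Rplus_le_compat; [apply HW|left; exact HN].
Qed.

(** Banach iteration from the zero function. The bounds [M] and [L] survive pointwise limits, so the
    limit is again in [BUC X]. The fixed point equation is stated pointwise, since elements of
    [BUC X] also carry proofs. *)
Lemma bounded_lipschitz_fixed_point (T : BUC X -> BUC X) (theta M L : R) :
  0 <= theta < 1 -> 0 <= M -> 0 <= L ->
  (forall v : BUC X, bounded_lipschitz M L v -> bounded_lipschitz M L (T v)) ->
  (forall (v w : BUC X) b, bounded_lipschitz M L v -> bounded_lipschitz M L w ->
     (forall t, norm (minus (v t) (w t)) <= b) ->
     forall t, norm (minus (T v t) (T w t)) <= theta * b) ->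
  exists w : BUC X, bounded_lipschitz M L w /\ forall t, T w t = w t.
Proof.
intros Ht HM HL Hinv Hcontr.
assert (H0 : bounded_lipschitz M L (fun _ => zero)).
{ split; intros t; [|intros s].
  - apply Rle_trans with 0; [right; exact (norm_zero (V := X))|exact HM].
  - rewrite (norm_minus_diag (X := X)).
    apply Rmult_le_pos; [exact HL|apply Rabs_pos]. }
destruct (bounded_lipschitz_BUC M L _ H0) as [W0 EW0]; rewrite <- EW0 in H0.
set (W := fun n => Nat.iter n T W0).
assert (HW : forall n, bounded_lipschitz M L (W n)).
{ induction n as [|n IH]; [exact H0|now apply Hinv]. }
(* [2 * M] bounds the distance of any two functions with norm at most [M]. *)
assert (Hcauchy : forall n m t,
  norm (minus (W (n + m)%nat t) (W n t)) <= 2 * M * theta ^ n).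
{ induction n as [|n IH]; intros m t; simpl Nat.add.
  - rewrite pow_O, Rmult_1_r; apply Rle_trans with (1 := norm_minus_le (X := X) _ _).
    generalize (proj1 (HW m) t) (proj1 (HW 0%nat) t); lra.
  - replace (2 * M * theta ^ S n) with (theta * (2 * M * theta ^ n))
      by (simpl; ring).
    apply (Hcontr (W (n + m)%nat) (W n)); auto. }
assert (Hlim : forall t, exists l, forall n,
  norm (minus l (W n t)) <= 2 * M * theta ^ n).
{ intros t; apply geometric_cauchy_limit; [exact Ht|intros; apply Hcauchy]. }
apply functional_choice in Hlim; destruct Hlim as [l Hl].
assert (Hbl : bounded_lipschitz M L l).
{ split.
  - intros t; apply (le_of_le_geometric theta _ _ (2 * M) Ht); intros n.
    apply Rle_trans with (1 := norm_le_minus (X := X) _ (W n t)).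
    generalize (Hl t n) (proj1 (HW n) t); lra.
  - intros t s; apply (le_of_le_geometric theta _ _ (2 * (2 * M)) Ht); intros n.
    apply Rle_trans with (1 := norm_minus_triangle (X := X) (W n t) _ _).
    apply Rle_trans with (2 * M * theta ^ n
      + (L * Rabs (t - s) + 2 * M * theta ^ n)); [|lra].
    apply Rplus_le_compat; [apply Hl|].
    apply Rle_trans with (1 := norm_minus_triangle (X := X) (W n s) _ _).
    apply Rplus_le_compat; [apply (proj2 (HW n))|].
    rewrite (norm_minus_sym (X := X)); apply Hl. }
destruct (bounded_lipschitz_BUC M L l Hbl) as [w Ew]; exists w; subst l.
split; [exact Hbl|intros t].
apply (ball_norm_eq (V := X)); intros eps; unfold ball_norm.
apply Rle_lt_trans with 0; [|apply cond_pos].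
(* Both [w t] and [T w t] lie within [2 * M * theta ^ S n] of [W (S n) t], the second by contraction
   from step [n]. *)
apply (le_of_le_geometric theta _ _ (2 * M * (2 * theta)) Ht); intros n.
apply Rle_trans with (1 := norm_minus_triangle (X := X) (W (S n) t) _ _).
replace (0 + 2 * M * (2 * theta) * theta ^ n)
  with (2 * M * theta ^ S n + theta * (2 * M * theta ^ n)) by (simpl; ring).
apply Rplus_le_compat; [apply Hl|].
rewrite (norm_minus_sym (X := X)); apply (Hcontr w (W n)); auto.
Qed.

End FixedPoint.

(** * Approximate solutions *)

(** With [z] the average of the unknown, the Yosida equation reads $(1-\lambda\omega)x-\lambda y=z$;
    dividing by $1-\lambda\omega$ gives the form used in [resolves]. *)
Lemma yosida_resolvent {X : NormedModule R_AbsRing} (lambda omega : R)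
  (x z y : X) :
  0 < lambda -> 0 < 1 - lambda * omega ->
  scal (/ lambda) (minus x z) = plus y (scal omega x) ->
  minus x (scal (lambda / (1 - lambda * omega)) y)
  = scal (/ (1 - lambda * omega)) z.
Proof.
intros Hl Hf H.
assert (Ey : y = plus (scal (/ lambda - omega) x) (scal (- / lambda) z)).
{ apply (plus_reg_r (G := X) (scal omega x)).
  etransitivity; [exact (eq_sym H)|].
  etransitivity; [exact (scal_minus_distr_l (/ lambda) x z)|].
  etransitivity; [|exact (eq_sym (plus_plus_swap (G := X) _ _ _))].
  unfold minus; f_equal; [|exact (opp_scal _ _)].
  etransitivity; [|exact (eq_sym (scal_Rplus _ _ _))]; f_equal; ring. }
assert (Es : scal (lambda / (1 - lambda * omega)) y
  = minus x (scal (/ (1 - lambda * omega)) z)).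
{ rewrite Ey; etransitivity; [exact (scal_distr_l _ _ _)|].
  unfold minus; f_equal.
  - etransitivity; [exact (scal_scal _ _ _)|].
    replace (_ * _) with 1 by (field; lra); apply scal_R1.
  - etransitivity; [exact (scal_scal _ _ _)|].
    etransitivity; [|exact (eq_sym (opp_scal _ _))]; f_equal; field; lra. }
rewrite Es; exact (minus_minus_cancel (G := X) _ _).
Qed.

(** Presents the Lipschitz constant as a bound on a real function of pairs, to which
    [sup_self_improvement] applies. On the diagonal the numerator is 0, hence so is the quotient. *)
Lemma lipschitz_with_ratio {X : NormedModule R_AbsRing} (f : R -> X) (b : R) :
  0 <= b ->
  lipschitz_with f b <->
  forall p : R * R,
    norm (minus (f (fst p)) (f (snd p))) / Rabs (fst p - snd p) <= b.
Proof.
intros Hb; split.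
- intros H [t s]; simpl; destruct (Req_dec t s) as [->|Hts].
  + rewrite norm_minus_diag; unfold Rdiv; rewrite Rmult_0_l; exact Hb.
  + assert (0 < Rabs (t - s)) by (apply Rabs_pos_lt; lra).
    apply Rmult_le_reg_r with (Rabs (t - s)); [easy|].
    unfold Rdiv; rewrite Rmult_assoc, Rinv_l, Rmult_1_r by lra; apply H.
- intros H t s; specialize (H (t, s)); simpl in H.
  destruct (Req_dec t s) as [->|Hts].
  + rewrite norm_minus_diag; apply Rmult_le_pos; [exact Hb|apply Rabs_pos].
  + assert (0 < Rabs (t - s)) by (apply Rabs_pos_lt; lra).
    replace (norm _) with (norm (minus (f t) (f s)) / Rabs (t - s) * Rabs (t - s))
      by (field; lra).
    apply Rmult_le_compat_r; lra.
Qed.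

(** * A priori bounds, the fixed point and the iterates *)

Section Scheme.

Context {X : CompleteNormedModule R_AbsRing} {d : delay}.
Variables (omega : R) (A : R -> history d X -> X -> X -> Prop).
Variables (g h k : R -> X) (K0 : R) (L1 L2 : R -> R) (Lg Lh Lk : R).
Hypothesis HA : forall t phi, m_dissipative (A t phi).
Hypothesis Hcontrol : lipschitz_control A g h k K0 L1 L2.
Hypotheses (Hg : lipschitz_with g Lg) (Hh : lipschitz_with h Lh)
  (Hk : lipschitz_with k Lk).
Hypothesis Homega : Lg + K0 < - omega.

Lemma constants_ge0 : 0 <= Lg /\ 0 <= Lh /\ 0 <= Lk /\ 0 < K0.
Proof.
repeat split; try (eapply lipschitz_with_ge0; eassumption); apply Hcontrol.
Qed.

Lemma omega_lt0 : omega < 0.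
Proof. generalize constants_ge0; lra. Qed.

Lemma control_constant_ge0 (M : R) :
  0 <= M -> 0 <= Lh * L1 M /\ 0 <= Lk * L2 M.
Proof.
intros HM; destruct constants_ge0 as (_ & H1 & H2 & _).
destruct Hcontrol as (_ & _ & _ & _ & HL1 & HL2 & _).
split; apply Rmult_le_pos; auto; [now apply HL1|now apply HL2].
Qed.

Lemma approximate_solution_resolves (lambda : R) (v u : BUC X) :
  0 < lambda -> approximate_solution omega A lambda v u ->
  resolves omega A lambda (segment d v) (average lambda u) u.
Proof.
intros Hl Hu t; destruct (Hu t) as [y [Hy E]].
exists y; split; [exact Hy|].
apply yosida_resolvent; [exact Hl| |exact E].
generalize (factor_gt1 omega omega_lt0 lambda Hl); lra.
Qed.

(** The range condition of m-dissipativity at each [t], followed by choice. Regularity in [t] is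
    obtained afterwards from the estimates. *)
Lemma resolves_exists (lambda : R) (phi : R -> history d X) (z : R -> X) :
  0 < lambda -> exists x, resolves omega A lambda phi z x.
Proof.
intros Hl; assert (Hf := factor_gt1 omega omega_lt0 lambda Hl).
apply (functional_choice (fun t x => exists y, A t (phi t) x y /\
  minus x (scal (lambda / (1 - lambda * omega)) y)
  = scal (/ (1 - lambda * omega)) (z t))); intros t.
apply (HA t (phi t)), Rdiv_lt_0_compat; lra.
Qed.

(** Comparison with one fixed element of the graph of [A] at time 0 and zero history; boundedness of
    [g], [h] and [k] makes the comparison uniform in [t]. The bound may depend on [lambda]. *)
Lemma resolves_bounded (lambda : R) :
  0 < lambda -> exists M, 0 <= M /\
  forall (v : BUC X) (w : R -> X), (forall t, norm (v t) <= M) ->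
    resolves omega A lambda (segment d v) (average lambda v) w ->
    forall t, norm (w t) <= M.
Proof.
intros Hl; assert (Hf := factor_gt1 omega omega_lt0 lambda Hl).
destruct constants_ge0 as (HLg & HLh & HLk & HK0).
destruct (bounded_lipschitz_BUC 0 0 (fun _ => zero : X)) as [v0 Ev0].
{ split; intros t; [right; exact (norm_zero (V := X))|intros s].
  rewrite (norm_minus_diag (X := X)); lra. }
(* The reference pair [x 0], [y], with right-hand side zero. *)
destruct (resolves_exists lambda (segment d v0) (fun _ => zero) Hl) as [x Hx].
destruct (Hx 0) as [y [HA0 E0]].
assert (Hb : forall f : R -> X, Defs.bounded f -> exists B, 0 <= B /\
  forall t s, norm (minus (f t) (f s)) <= B).
{ intros f [B HB]; exists (B + B); split.
  - generalize (HB 0) (norm_ge_0 (f 0)); lra.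
  - intros t s; apply Rle_trans with (1 := norm_minus_le (X := X) _ _).
    now apply Rplus_le_compat. }
assert (HC := Hcontrol).
destruct HC as ([Hbg _] & [Hbh _] & [Hbk _] & _ & HL1 & HL2 & _).
destruct (Hb g Hbg) as [Bg [HBg0 HBg]], (Hb h Hbh) as [Bh [HBh0 HBh]],
  (Hb k Hbk) as [Bk [HBk0 HBk]].
assert (HL1x : 0 <= L1 (norm (x 0))) by apply HL1, norm_ge_0.
assert (HL2x : 0 <= L2 (history_norm (segment d v0 0)))
  by apply HL2, sup_norm_ge0.
assert (Hx0 := norm_ge_0 (x 0)); assert (Hy0 := norm_ge_0 y).
set (C := Bh * L1 (norm (x 0)) + Bg * norm y
  + Bk * L2 (history_norm (segment d v0 0))).
assert (HC : 0 <= C).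
{ unfold C; repeat apply Rplus_le_le_0_compat; now apply Rmult_le_pos. }
set (f := 1 - lambda * omega) in *.
assert (Hgap : 0 < lambda * (- omega - K0)) by (apply Rmult_lt_0_compat; lra).
(* [M] solves $fM = M+\lambda(C+K_0M)+f\|x(0)\|$, so the ball of radius [M] is preserved. *)
set (M := (f * norm (x 0) + lambda * C) / (lambda * (- omega - K0))).
assert (HM : M * (lambda * (- omega - K0)) = f * norm (x 0) + lambda * C).
{ unfold M; field; lra. }
assert (HM0 : 0 <= M).
{ apply Rdiv_le_0_compat; [|exact Hgap].
  apply Rplus_le_le_0_compat; apply Rmult_le_pos; lra. }
exists M; split; [exact HM0|]; intros v w Hv Hw t.
destruct (Hw t) as [y1 [HA1 E1]].
assert (Hz : norm (minus (average lambda v t) zero) <= M).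
{ apply Rle_trans with (1 := norm_minus_le (X := X) _ _).
  assert (E := norm_zero (V := X)).
  assert (Ha := average_bound lambda v t M Hl Hv).
  apply Rle_trans with (M + 0); [|lra].
  apply Rplus_le_compat; [exact Ha|right; exact E]. }
assert (Hd : history_dist (segment d v t) (segment d v0 0) <= M).
{ apply history_dist_segment_le; [exact HM0|intros r; rewrite Ev0].
  apply Rle_trans with (1 := norm_minus_le (X := X) _ _).
  apply Rle_trans with (M + 0); [|lra].
  apply Rplus_le_compat; [apply Hv|right; exact (norm_zero (V := X))]. }
assert (HbC : norm (minus (h t) (h 0)) * L1 (norm (x 0))
  + norm (minus (g t) (g 0)) * norm y
  + norm (minus (k t) (k 0)) * L2 (history_norm (segment d v0 0)) <= C).
{ unfold C; repeat apply Rplus_le_compat; apply Rmult_le_compat_r; auto. }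
assert (HKd : K0 * history_dist (segment d v t) (segment d v0 0) <= K0 * M)
  by (apply Rmult_le_compat_l; lra).
assert (H : f * norm (minus (w t) (x 0)) <= M + lambda * (C + K0 * M)).
{ eapply Rle_trans.
  { exact (resolvent_estimate omega A g h k K0 L1 L2 omega_lt0 Hcontrol
      _ _ _ _ _ _ _ _ _ _ _ Hl HA1 HA0 E1 E0). }
  apply Rplus_le_compat; [exact Hz|].
  apply Rmult_le_compat_l; [lra|apply Rplus_le_compat; [exact HbC|exact HKd]]. }
apply Rmult_le_reg_l with f; [lra|].
apply Rle_trans with (f * (norm (minus (w t) (x 0)) + norm (x 0))).
{ apply Rmult_le_compat_l; [lra|apply (norm_le_minus (X := X))]. }
replace (f * M) with (M * (lambda * (- omega - K0)) + (M + lambda * (K0 * M)))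
  by (unfold f; ring).
lra.
Qed.

Lemma resolves_bounded_lipschitz (lambda : R) :
  0 < lambda -> exists M L, 0 <= M /\ 0 <= L /\
  forall (v : BUC X) (w : R -> X), bounded_lipschitz M L v ->
    resolves omega A lambda (segment d v) (average lambda v) w ->
    bounded_lipschitz M L w.
Proof.
intros Hl; assert (Hf := factor_gt1 omega omega_lt0 lambda Hl).
destruct constants_ge0 as (HLg & HLh & HLk & HK0).
destruct (resolves_bounded lambda Hl) as [M [HM Hbound]].
destruct (control_constant_ge0 M HM) as [Hc1 Hc2].
set (f := 1 - lambda * omega) in *.
assert (Hmu : 0 < lambda / f) by (apply Rdiv_lt_0_compat; lra).
(* Crude bound: [scal (lambda / f) y] is a difference of two terms of norm at most [M]. It blows up
   as [lambda] tends to 0, which is harmless while [lambda] is fixed. *)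
set (Y := 2 * M / (lambda / f)).
assert (HY : 0 <= Y) by (apply Rdiv_le_0_compat; lra).
assert (HYM : lambda / f * Y = 2 * M) by (unfold Y; field; lra).
set (C := Lh * L1 M + Lg * Y + Lk * L2 M).
assert (HC : 0 <= C).
{ unfold C; assert (0 <= Lg * Y) by now apply Rmult_le_pos.
  lra. }
(* [L] solves $fL=L+\lambda(C+K_0L)$, so the Lipschitz bound reproduces itself. *)
set (L := C / (- omega - K0)).
assert (HL : L * (- omega - K0) = C) by (unfold L; field; lra).
assert (HL0 : 0 <= L) by (apply Rdiv_le_0_compat; lra).
exists M, L; split; [exact HM|split; [exact HL0|]].
intros v w [HvM HvL] Hw; assert (HwM := Hbound v w HvM Hw).
split; [exact HwM|intros t s].
apply Rmult_le_reg_l with f; [lra|].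
eapply Rle_trans.
{ apply (resolves_shift omega A g h k K0 L1 L2 omega_lt0 Hcontrol Lg Lh Lk
    Hg Hh Hk lambda v _ w M Y L Hl Hw HvM HwM HvL).
  intros r; fold f; rewrite HYM.
  apply Rle_trans with (1 := norm_minus_le (X := X) _ _).
  replace (2 * M) with (M + 1 * M) by ring; apply Rplus_le_compat; [apply HwM|].
  apply Rle_trans with (1 := norm_scal_le (X := X) _ _).
  apply Rmult_le_compat; [apply Rabs_pos|apply norm_ge_0| |now apply average_bound].
  rewrite Rabs_pos_eq by (left; apply Rinv_0_lt_compat; lra).
  rewrite <- Rinv_1; apply Rinv_le_contravar; lra. }
fold C.
assert (Ha : norm (minus (average lambda v t) (average lambda v s))
  <= L * Rabs (t - s)).
{ apply average_dist; [exact Hl|intros tau _].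
  apply Rle_trans with (1 := HvL _ _).
  replace (t - tau - (s - tau)) with (t - s) by ring; apply Rle_refl. }
replace (f * (L * Rabs (t - s))) with (L * Rabs (t - s)
  + lambda * (L * (- omega - K0) + K0 * L) * Rabs (t - s)) by (unfold f; ring).
rewrite HL; apply Rplus_le_compat_r; exact Ha.
Qed.

(** Solution of [(d/dt)_lambda w(t) ∈ A(t, w_t) w(t) + omega w(t)], where
    also the history argument is that of [w]. *)
Lemma delayed_fixed_point (lambda : R) :
  0 < lambda -> exists M L (w : BUC X), bounded_lipschitz M L w /\
    resolves omega A lambda (segment d w) (average lambda w) w.
Proof.
intros Hl; assert (Hf := factor_gt1 omega omega_lt0 lambda Hl).
destruct constants_ge0 as (HLg & _ & _ & HK0).
destruct (resolves_bounded_lipschitz lambda Hl) as (M & L & HM & HL & Hstep).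
assert (HT : forall v : BUC X, exists w : BUC X, bounded_lipschitz M L v ->
  bounded_lipschitz M L w /\
  resolves omega A lambda (segment d v) (average lambda v) w).
{ intros v.
  destruct (resolves_exists lambda (segment d v) (average lambda v) Hl) as [x Hx].
  (* [T] must be total on [BUC X]; outside the invariant set its value is arbitrary, here [v]. *)
  destruct (classic (bounded_lipschitz M L v)) as [Hv|Hv]; [|now exists v].
  destruct (bounded_lipschitz_BUC M L x) as [w Ew]; [now apply (Hstep v)|].
  exists w; intros _; rewrite Ew; split; [now apply (Hstep v)|exact Hx]. }
apply functional_choice in HT; destruct HT as [T HT].
exists M, L.
(* In the contraction factor, 1 comes from the average and [lambda * K0] from the history; it is
   below 1 because [K0 < - omega]. *)
destruct (bounded_lipschitz_fixed_point T
  ((1 + lambda * K0) / (1 - lambda * omega)) M L) as [w [Hw Efix]]; auto.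
- assert (0 < lambda * K0) by now apply Rmult_lt_0_compat.
  assert (0 < lambda * (- omega - K0)) by (apply Rmult_lt_0_compat; lra).
  split; [left; apply Rdiv_lt_0_compat; lra|].
  apply Rmult_lt_reg_r with (1 - lambda * omega); [lra|].
  unfold Rdiv; rewrite Rmult_assoc, Rinv_l by lra; lra.
- intros v Hv; now apply HT.
- intros v w b Hv Hw Hb t.
  assert (Hb0 : 0 <= b) by (apply Rle_trans with (2 := Hb 0), norm_ge_0).
  apply Rmult_le_reg_l with (1 - lambda * omega); [lra|].
  eapply Rle_trans.
  { apply (resolves_dist omega A g h k K0 L1 L2 omega_lt0 Hcontrol lambda v w
      (average lambda v) (average lambda w) _ _ b b Hl Hb0);
      [now apply HT|now apply HT| |exact Hb].
    intros s; apply average_dist; auto. }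
  right; field; lra.
- exists w; split; [exact Hw|intros t].
  destruct (proj2 (HT w Hw) t) as [y Hy]; rewrite (Efix t) in Hy; now exists y.
Qed.

(** A Lipschitz constant [b] of [w] improves to [theta * b + lambda * C / f], because the Yosida
    derivative of [w] is itself at most [b]. The given [L] only starts this self-improvement, and
    [lambda] cancels in the resulting constant. *)
Lemma delayed_fixed_point_lipschitz (lambda M L : R) (w : BUC X) :
  0 < lambda -> bounded_lipschitz M L w ->
  resolves omega A lambda (segment d w) (average lambda w) w ->
  lipschitz_with w
    ((Lh * L1 M + Lg * (- omega * M) + Lk * L2 M) / (- omega - (Lg + K0))).
Proof.
intros Hl [HwM HwL] Hw; assert (Hf := factor_gt1 omega omega_lt0 lambda Hl).
destruct constants_ge0 as (HLg & HLh & HLk & HK0).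
assert (HM : 0 <= M) by (apply Rle_trans with (2 := HwM 0), norm_ge_0).
destruct (control_constant_ge0 M HM) as [Hc1 Hc2].
set (C := Lh * L1 M + Lg * (- omega * M) + Lk * L2 M).
assert (HC : 0 <= C).
{ assert (0 <= Lg * (- omega * M)); [|unfold C; lra].
  assert (Homega0 := omega_lt0); repeat apply Rmult_le_pos; lra. }
set (f := 1 - lambda * omega) in *.
assert (Hgap : 0 < lambda * (- omega - (Lg + K0)))
  by (apply Rmult_lt_0_compat; lra).
assert (HLK : 0 < lambda * (Lg + K0)) by (apply Rmult_lt_0_compat; lra).
(* The summands come from the average, from the term with [g] and from the history; [theta < 1] is
   the hypothesis [Lg + K0 < - omega]. *)
set (theta := (1 + lambda * (Lg + K0)) / f).
assert (Htheta : 0 <= theta) by (apply Rdiv_le_0_compat; lra).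
assert (HCl : 0 <= lambda * C / f).
{ apply Rdiv_le_0_compat; [apply Rmult_le_pos|]; lra. }
apply lipschitz_with_ratio; [apply Rdiv_le_0_compat; lra|].
replace (C / (- omega - (Lg + K0))) with (lambda * C / f / (1 - theta)).
2: { unfold theta, f; field; repeat split; try (fold f; lra).
     replace (1 - lambda * omega - (1 + lambda * (Lg + K0)))
       with (lambda * (- omega - (Lg + K0))) by ring; lra. }
apply sup_self_improvement with L.
- apply Rmult_lt_reg_r with f; [lra|].
  unfold theta, Rdiv; rewrite Rmult_assoc, Rinv_l by lra; unfold f; lra.
- apply lipschitz_with_ratio; [exact (lipschitz_with_ge0 w L HwL)|exact HwL].
- intros b Hb.
  assert (Hb0 : 0 <= b).
  { apply Rle_trans with (2 := Hb (0, 0)); simpl.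
    rewrite (norm_minus_diag (X := X)); unfold Rdiv; rewrite Rmult_0_l; lra. }
  apply lipschitz_with_ratio in Hb; [|exact Hb0].
  apply lipschitz_with_ratio.
  { apply Rplus_le_le_0_compat; [now apply Rmult_le_pos|exact HCl]. }
  intros t s; apply Rmult_le_reg_l with f; [lra|].
  eapply Rle_trans.
  { apply (resolves_shift omega A g h k K0 L1 L2 omega_lt0 Hcontrol Lg Lh Lk
      Hg Hh Hk lambda w _ w M (b + - omega * M) b Hl Hw HwM HwM Hb).
    intros r; fold f.
    apply Rle_trans with
      (1 := norm_minus_triangle (X := X) (scal (/ f) (w r)) _ _).
    (* Here $1-1/f=-\lambda\omega/f$. So [y] is bounded by [b], for the Yosida derivative, plus
       [- omega * M], for [scal omega (w r)]. *)
    replace (lambda / f * (b + - omega * M))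
      with ((1 - / f) * M + / f * (lambda * b)) by (unfold f; field; fold f; lra).
    assert (Hinv : 0 < / f <= 1).
    { split; [apply Rinv_0_lt_compat; lra|].
      rewrite <- Rinv_1; apply Rinv_le_contravar; lra. }
    apply Rplus_le_compat.
    - replace (minus (w r) (scal (/ f) (w r))) with (scal (1 - / f) (w r)).
      + apply Rle_trans with (1 := norm_scal_le (X := X) _ _).
        rewrite Rabs_pos_eq by lra; apply Rmult_le_compat_l; [lra|apply HwM].
      + etransitivity; [exact (scal_minus_distr_r 1 (/ f) (w r))|].
        f_equal; exact (scal_one (w r)).
    - apply Rle_trans with (1 := norm_minus_scal_le (X := X) _ _ _).
      rewrite Rabs_pos_eq by lra; apply Rmult_le_compat_l; [lra|].
      now apply minus_average_lipschitz. }
  assert (Ha : norm (minus (average lambda w t) (average lambda w s))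
    <= b * Rabs (t - s)).
  { apply average_dist; [exact Hl|intros tau _].
    apply Rle_trans with (1 := Hb _ _).
    replace (t - tau - (s - tau)) with (t - s) by ring; apply Rle_refl. }
  replace (f * ((theta * b + lambda * C / f) * Rabs (t - s)))
    with (((1 + lambda * (Lg + K0)) * b + lambda * C) * Rabs (t - s))
    by (unfold theta; field; lra).
  eapply Rle_trans; [apply Rplus_le_compat_r; exact Ha|unfold C; lra].
Qed.

(** The unknown [u] also enters through its average, so [resolves_dist] gives an improvement of the
    distance with factor [/ f]; its fixed point is [K0 / - omega * c], free of [lambda]. *)
Lemma approximate_solution_dist (lambda c : R) (v u w : BUC X) :
  0 < lambda -> approximate_solution omega A lambda v u ->
  resolves omega A lambda (segment d w) (average lambda w) w ->
  (forall t, norm (minus (v t) (w t)) <= c) ->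
  forall t, norm (minus (u t) (w t)) <= K0 / - omega * c.
Proof.
intros Hl Hu Hw Hc; assert (Hf := factor_gt1 omega omega_lt0 lambda Hl).
assert (Hc0 : 0 <= c) by (apply Rle_trans with (2 := Hc 0), norm_ge_0).
assert (Homega0 := omega_lt0).
assert (0 < lambda * - omega) by (apply Rmult_lt_0_compat; lra).
apply approximate_solution_resolves in Hu; [|exact Hl].
set (f := 1 - lambda * omega) in *.
replace (K0 / - omega * c) with (lambda * K0 * c / f / (1 - / f)).
2: { unfold f; field; repeat split; try lra; fold f; lra. }
destruct (BUC_bounded _ u) as [Mu HMu], (BUC_bounded _ w) as [Mw HMw].
apply sup_self_improvement with (Mu + Mw).
- rewrite <- Rinv_1; apply Rinv_lt_contravar; lra.
- intros t; apply Rle_trans with (1 := norm_minus_le (X := X) _ _).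
  now apply Rplus_le_compat.
- intros b Hb t; apply Rmult_le_reg_l with f; [lra|].
  eapply Rle_trans.
  { apply (resolves_dist omega A g h k K0 L1 L2 omega_lt0 Hcontrol lambda v w
      (average lambda u) (average lambda w) _ _ b c Hl Hc0 Hu Hw); [|exact Hc].
    intros s; apply average_dist; auto. }
  right; field; lra.
Qed.

Lemma recursion_dist (lambda c : R) (psi w : BUC X) (U : nat -> R -> BUC X) :
  0 < lambda -> recursion_from omega A psi U ->
  resolves omega A lambda (segment d w) (average lambda w) w ->
  (forall t, norm (minus (psi t) (w t)) <= c) ->
  forall n t, norm (minus (U n lambda t) (w t)) <= c * (K0 / - omega) ^ n.
Proof.
intros Hl HU Hw Hc; destruct (HU lambda Hl) as [E0 HS].
induction n as [|n IH]; intros t.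
- rewrite E0, pow_O, Rmult_1_r; apply Hc.
- replace (c * (K0 / - omega) ^ S n)
    with (K0 / - omega * (c * (K0 / - omega) ^ n)) by (simpl; ring).
  now apply (approximate_solution_dist lambda _ (U n lambda)).
Qed.

(** * Passage to the limit in [lambda] and [n] *)

Lemma filterlim_uniform_norm {T : Type} {F : (T -> Prop) -> Prop}
  {FF : Filter F} (f : T -> R -> X) (l : R -> X) (eps : R) :
  filterlim f F (locally (T := fct_UniformSpace R X) l) -> 0 < eps ->
  F (fun x => forall t, norm (minus (f x t) (l t)) < eps).
Proof.
intros Hf Heps; assert (Hnf := norm_factor_gt_0 (V := X)).
(* A ball of the uniform structure is contained in a norm ball enlarged by [norm_factor]. *)
assert (He : 0 < eps / norm_factor (V := X)) by now apply Rdiv_lt_0_compat.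
generalize (proj1 (filterlim_locally (U := fct_UniformSpace R X) f l) Hf
  (mkposreal _ He)).
apply filter_imp; intros x Hx t.
apply Rlt_le_trans with (1 := norm_compat2 (V := X) _ _ _ (Hx t)).
simpl; right; field; lra.
Qed.

Lemma at_right_0_pos : at_right 0 (fun x => 0 < x).
Proof. apply (filter_forall (F := locally 0)); auto. Qed.

Lemma solution_lipschitz (u : R -> X) : is_solution omega A u -> lipschitz u.
Proof.
intros (psi & U & v & HU & Hv & Hlim).
assert (Homega0 := omega_lt0); destruct constants_ge0 as (HLg & _ & _ & HK0).
set (rho := K0 / - omega).
assert (Hrho : 0 <= rho < 1).
{ split; [apply Rdiv_le_0_compat; lra|].
  apply Rmult_lt_reg_r with (- omega); [lra|].
  unfold rho, Rdiv; rewrite Rmult_assoc, Rinv_l; lra. }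
destruct (BUC_bounded _ psi) as [Mpsi HMpsi].
(* A single [lambda0] bounds [v 1]; then [U 1 lambda] is bounded by [M0 + 2] for all small
   [lambda]. *)
assert (H1 := filterlim_uniform_norm _ _ 1 (Hv 1%nat (le_n 1)) Rlt_0_1).
destruct (filter_ex _ H1) as [lambda0 Hlambda0].
destruct (BUC_bounded _ (U 1%nat lambda0)) as [M0 HM0].
assert (Hv1 : forall t, norm (v 1%nat t) <= M0 + 1).
{ intros t.
  apply Rle_trans with (1 := norm_le_minus (X := X) _ (U 1%nat lambda0 t)).
  rewrite (norm_minus_sym (X := X)), Rplus_comm.
  apply Rplus_le_compat; [apply HM0|left; apply Hlambda0]. }
(* If [b] bounds [w], then so does [M0 + 2 + rho * (Mpsi + b)], by comparing [w] with [U 1 lambda];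
   [M] is the fixed value of this improvement. *)
set (M := (M0 + 2 + rho * Mpsi) / (1 - rho)).
assert (Hbound : forall lambda (w : BUC X), 0 < lambda ->
  (forall t, norm (minus (U 1%nat lambda t) (v 1%nat t)) < 1) ->
  resolves omega A lambda (segment d w) (average lambda w) w ->
  forall t, norm (w t) <= M).
{ intros lambda w Hl HU1 Hw; destruct (BUC_bounded _ w) as [Mw HMw].
  apply sup_self_improvement with Mw; [lra|exact HMw|intros b Hb t].
  apply Rle_trans with (1 := norm_le_minus (X := X) _ (U 1%nat lambda t)).
  rewrite (norm_minus_sym (X := X)).
  assert (Hd : norm (minus (U 1%nat lambda t) (w t)) <= (Mpsi + b) * rho ^ 1).
  { apply (recursion_dist lambda (Mpsi + b) psi w U Hl HU Hw).
    intros s; apply Rle_trans with (1 := norm_minus_le (X := X) _ _).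
    now apply Rplus_le_compat. }
  assert (HU1t : norm (U 1%nat lambda t) <= 1 + (M0 + 1)).
  { apply Rle_trans with (1 := norm_le_minus (X := X) _ (v 1%nat t)).
    apply Rplus_le_compat; [left; apply HU1|apply Hv1]. }
  simpl in Hd; lra. }
exists ((Lh * L1 M + Lg * (- omega * M) + Lk * L2 M) / (- omega - (Lg + K0))).
intros t s; apply Rle_plus_epsilon; intros eps Heps.
assert (Hgeom : is_lim_seq (fun n => (Mpsi + M) * rho ^ n) 0).
{ replace (Finite 0) with (Finite ((Mpsi + M) * 0)) by (f_equal; ring).
  apply (is_lim_seq_scal_l _ (Mpsi + M) 0), is_lim_seq_geom.
  rewrite Rabs_pos_eq; lra. }
(* Three errors separate [u] from [w]: the limit in [n], the limit in [lambda], and the iteration.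
   Each is incurred at [t] and at [s]. *)
assert (Heps6 : 0 < eps / 6) by lra.
destruct (filter_ex (F := eventually) _ (filter_and _ _
  (filter_and _ _ (filterlim_uniform_norm v u _ Hlim Heps6)
    (proj1 (filterlim_locally_ball_norm (U := R_NormedModule) _ _) Hgeom
      (mkposreal _ Heps6)))
  (ex_intro (fun N => forall n, (N <= n)%nat -> (1 <= n)%nat) 1%nat
    (fun n Hn => Hn)))) as [n [[Hvn Hgn] Hn]].
(* [lambda] is chosen after [n], since the convergence in [lambda] need not be uniform in [n]. *)
destruct (filter_ex (F := at_right 0) _ (filter_and _ _
  (filter_and _ _ H1 at_right_0_pos)
  (filterlim_uniform_norm _ _ _ (Hv n Hn) Heps6)))
  as [lambda [[HU1 Hl] HUn]].
destruct (delayed_fixed_point lambda Hl) as (Mw & L & w & [_ HwL] & Hw).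
(* The bound supplied with [w] depends on [lambda]; it is replaced by the uniform [M]. *)
assert (HwM := Hbound lambda w Hl HU1 Hw).
assert (Hlip := delayed_fixed_point_lipschitz lambda M L w Hl
  (conj HwM HwL) Hw).
assert (Huw : forall r, norm (minus (u r) (w r)) <= 3 * (eps / 6)).
{ intros r.
  assert (Hd : norm (minus (U n lambda r) (w r)) <= (Mpsi + M) * rho ^ n).
  { apply (recursion_dist lambda (Mpsi + M) psi w U Hl HU Hw).
    intros r'; apply Rle_trans with (1 := norm_minus_le (X := X) _ _).
    now apply Rplus_le_compat. }
  change (Rabs ((Mpsi + M) * rho ^ n - 0) < eps / 6) in Hgn.
  rewrite Rminus_0_r in Hgn; assert (Habs := Rle_abs ((Mpsi + M) * rho ^ n)).
  replace (3 * (eps / 6)) with (eps / 6 + (eps / 6 + eps / 6)) by ring.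
  apply Rle_trans with (1 := norm_minus_triangle (X := X) (v n r) _ _).
  apply Rplus_le_compat; [rewrite (norm_minus_sym (X := X)); left; apply Hvn|].
  apply Rle_trans with (1 := norm_minus_triangle (X := X) (U n lambda r) _ _).
  apply Rplus_le_compat; [rewrite (norm_minus_sym (X := X)); left; apply HUn|].
  apply Rle_trans with (1 := Hd); lra. }
replace eps with (3 * (eps / 6) + 3 * (eps / 6)) by field.
apply Rle_trans with (1 := norm_minus_triangle (X := X) (w t) _ _).
rewrite (Rplus_comm (_ * _)), Rplus_assoc; apply Rplus_le_compat; [apply Huw|].
apply Rle_trans with (1 := norm_minus_triangle (X := X) (w s) _ _).
rewrite Rplus_comm; apply Rplus_le_compat; [|apply Hlip].
rewrite (norm_minus_sym (X := X)); apply Huw.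
Qed.

End Scheme.

Theorem theorem3p5 (X : CompleteNormedModule R_AbsRing) (d : delay) (omega : R)
  (A : R -> history d X -> X -> X -> Prop)
  (HA : forall t phi, m_dissipative (A t phi))
  (Hcontrol :
     (exists (h k : R -> X) (K0 : R) (L1 L2 : R -> R),
        unif_continuous_control A h k K0 L1 L2 /\
        lipschitz h /\ lipschitz k /\ K0 < - omega) \/
     (exists (g h k : R -> X) (K0 : R) (L1 L2 : R -> R) (Lg : R),
        lipschitz_control A g h k K0 L1 L2 /\
        lipschitz_with g Lg /\ Lg + K0 < - omega))
  (u : R -> X) (Hu : is_solution omega A u) :
  lipschitz u.
Proof.
assert (H : exists (g h k : R -> X) (K0 : R) (L1 L2 : R -> R) (Lg : R),
  lipschitz_control A g h k K0 L1 L2 /\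
  lipschitz_with g Lg /\ Lg + K0 < - omega).
{ destruct Hcontrol as [(h & k & K0 & L1 & L2 & Hc & Hh & Hk & Homega)|H];
    [|exact H].
  assert (H0 : lipschitz_with (fun _ : R => zero : X) 0).
  { intros t s; rewrite (norm_minus_diag (X := X)); lra. }
  exists (fun _ => zero), h, k, K0, L1, L2, 0.
  destruct Hc as ([Hbh _] & [Hbk _] & HK0 & HL1 & HL2 & Hc).
  split; [|split; [exact H0|lra]].
  repeat split; auto; try apply HL1; try apply HL2.
  - exists 0; intros _; right; exact (norm_zero (V := X)).
  - now exists 0.
  - intros; rewrite (norm_minus_diag (X := X)), Rmult_0_r, Rmult_0_l, Rplus_0_r.
    now apply Hc. }
destruct H as (g & h & k & K0 & L1 & L2 & Lg & Hc & Hg & Homega).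
assert (Hc' := Hc); destruct Hc' as (_ & [_ [Lh Hh]] & [_ [Lk Hk]] & _).
exact (solution_lipschitz omega A g h k K0 L1 L2 Lg Lh Lk HA Hc Hg Hh Hk
  Homega u Hu).
Qed.
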